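(* Let $\lambda_0>\Theta>0$. Assume that, for all $r>0$, $$\inf_{x\in B_1}\int_{B_r\cap B_1}K(x,y)\,dy>0.$$ Then there exist $\overline c>0$, depending only on $n$, $\lambda_0$, $\Theta$ and $K$, and $\alpha>0$, depending only on $\lambda_0$, $\Theta$ and $K$, such that the following holds. If $0<c\le\overline c$ and $u$ is a solution of $$\partial_t u(x,t)=c\Delta u(x,t)+\int_{B_1}\big(u(y,t)-\Theta\big)_+\,K(x,y)\,dy\qquad\text{in }B_1\times(0,+\infty),$$ with $u(x,t)=0$ for all $x\in\partial B_1$ and $t\in[0,+\infty)$, and $$u(x,0)\ge\lambda_0(1-|x|^2)\qquad\text{for all }x\in B_1,$$ then, for all $x\in B_1$, $$\lim_{t\to+\infty}u(x,t)=+\infty,$$ and, more precisely, for all $x\in B_1$ and $t\in[0,+\infty)$, $$u(x,t)\ge\lambda_0e^{\alpha t}(1-|x|^2).$$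
   Context: $B_r\subset\mathbb{R}^n$ denotes the open ball of radius $r$ centered at the origin, and $r_+:=\max\{r,0\}$ for $r\in\mathbb{R}$. The Laplacian $\Delta$ acts in the space variable $x$. The kernel $K:B_1\times B_1\to[0,+\infty)$ is measurable, nonnegative and integrable, with $\sup_{x\in B_1}\int_{B_1}K(x,y)\,dy<+\infty$. Solutions are classical: $u:\overline{B_1}\times[0,+\infty)\to\mathbb{R}$ is continuous, for every $x\in B_1$ the map $(0,+\infty)\ni t\mapsto u(x,t)$ is continuously differentiable, and for every $t\in(0,+\infty)$ the map $B_1\ni x\mapsto u(x,t)$ is twice continuously differentiable. *)

(* Defs.v *)
From HB Require Import structures.
From mathcomp Require Import all_boot all_order all_algebra.
From mathcomp Require Import all_classical all_reals all_analysis.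
From mathcomp Require Import measurable_realfun.
Set Implicit Arguments.
Unset Strict Implicit.
Unset Printing Implicit Defensive.
Import Order.TTheory GRing.Theory Num.Theory.
Import numFieldNormedType.Exports.

Local Open Scope classical_set_scope.
Local Open Scope ring_scope.

(* R^n is 'rV[R]_n.  The library norm on 'rV[R]_n is the sup norm (with the
   usual topology), so the Euclidean norm is introduced separately. *)
Definition enorm (R : realType) (n : nat) (x : 'rV[R]_n) : R :=
  Num.sqrt (\sum_(i < n) x 0 i ^+ 2).

Definition eball (R : realType) (n : nat) (r : R) : set 'rV[R]_n :=
  [set x | enorm x < r].

Definition boundary (T : topologicalType) (A : set T) : set T :=
  closure A `\` interior A.

Definition basis_vec (R : realType) (n : nat) (i : 'I_n) : 'rV[R]_n :=
  delta_mx 0 i.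

Definition laplacian (R : realType) (n : nat) (f : 'rV[R]_n -> R)
    (x : 'rV[R]_n) : R :=
  \sum_(i < n) 'D_(basis_vec R i) ('D_(basis_vec R i) f) x.

(* Continuous differentiability on an open set A, via partial derivatives. *)
Definition C1_on (R : realType) (n : nat) (A : set 'rV[R]_n)
    (f : 'rV[R]_n -> R) : Prop :=
  forall i : 'I_n,
    (forall x, A x -> derivable f x (basis_vec R i)) /\
    {in A, continuous ('D_(basis_vec R i) f)}.

Definition C2_on (R : realType) (n : nat) (A : set 'rV[R]_n)
    (f : 'rV[R]_n -> R) : Prop :=
  C1_on A f /\ forall i : 'I_n, C1_on A ('D_(basis_vec R i) f).

(* R^n with its Borel sigma-algebra. *)
Notation borelRn R n := (g_sigma_algebraType (@open 'rV[R]_n)).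

Definition cons_rV (R : realType) (n : nat) (p : R * 'rV[R]_n) :
  'rV[R]_n.+1 := row_mx p.1%:M p.2.

(* Lebesgue measure on the Borel sets of R^n, as the n-fold product of the
   Lebesgue measure on R. *)
Fixpoint borel_lebesgue (R : realType) (n : nat) :
    set (borelRn R n) -> \bar R :=
  match n with
  | 0%N => \d_(0 : borelRn R 0)
  | m.+1 => pushforward
      (product_measure1 (@lebesgue_measure R) (@borel_lebesgue R m))
      (@cons_rV R m : measurableTypeR R * borelRn R m -> borelRn R m.+1)
  end.
Arguments borel_lebesgue : clear implicits.

Section borel_lebesgue_measure.
Context {R : realType}.

Lemma open_bigcup_rat n (U : set 'rV[R]_n) : open U ->
  U = \bigcup_(q in [set q : 'rV[rat]_n * nat |
        ball (map_mx ratr q.1 : 'rV[R]_n) q.2.+1%:R^-1 `<=` U])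
      ball (map_mx ratr q.1 : 'rV[R]_n) q.2.+1%:R^-1.
Proof.
move=> oU; apply/seteqP; split => [x Ux|x [q qU] qx]; last exact: qU.
have /nbhs_ballP[e /= e0 eU] : nbhs x U by exact: open_nbhs_nbhs.
have [k ke] : exists k, k.+1%:R^-1 < e / 2 :> R.
  have e20 : 0 < e / 2 by rewrite divr_gt0.
  have [k _ /(_ k (leqnn k))] := near_infty_natSinv_lt (PosNum e20).
  by exists k.
have k0 : 0 < k.+1%:R^-1 :> R by rewrite invr_gt0.
have H (j : 'I_n) : exists r : rat, `|ratr r - x 0 j| < k.+1%:R^-1.
  have /rat_in_itvoo[r /itvP rx] : x 0 j - k.+1%:R^-1 < x 0 j + k.+1%:R^-1.
    by rewrite ltrBlDr -addrA ltrDl addr_gt0.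
  by exists r; rewrite ltr_distl !rx.
pose q : 'rV[rat]_n := \row_j sval (cid (H j)).
have qx : ball (map_mx ratr q : 'rV[R]_n) k.+1%:R^-1 x.
  split => // i j; rewrite ord1 !mxE /ball /= .
  exact: (svalP (cid (H j))).
exists (q, k) => //= y qy; apply: eU.
apply: (@le_ball _ _ x (e / 2 + e / 2)); first by rewrite -splitr.
have qye := le_ball (ltW ke) qy; have qxe := le_ball (ltW ke) qx.
exact: ball_triangle (ball_sym qxe) qye.
Qed.

Lemma measurable_fun_rV d (T : measurableType d) n (f : T -> borelRn R n) :
  (forall j, measurable_fun setT (fun x => f x ord0 j)) -> measurable_fun setT f.
Proof.
move=> mf; have := @measurability _ _ T (borelRn R n) setT f (@open 'rV[R]_n) erefl.
apply.
move=> _ [U oU <-]; rewrite setTI (open_bigcup_rat oU) preimage_bigcup.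
rewrite bigcup_mkcond; apply: countable_bigcupT_measurable => [|q]; first exact: countableP.
case: ifPn => // _.
rewrite [X in measurable X](_ : _ = \bigcap_(j in [set: 'I_n])
    ((fun x => f x ord0 j) @^-1` ball (ratr (q.1 ord0 j) : R) q.2.+1%:R^-1)).
  apply: fin_bigcap_measurable; first exact: finite_finset.
  move=> j _; rewrite -[X in measurable X]setTI; apply: mf => //.
  by apply: open_measurable; exact: ball_open.
apply/seteqP; split => [x /= [_ fx] j _ /=|x /= fx].
  by have := fx ord0 j; rewrite mxE.
split => [|i j]; first by rewrite invr_gt0.
by rewrite ord1 mxE; exact: fx.
Qed.

Lemma measurable_coord n j :
  measurable_fun setT (fun x : borelRn R n => (x : 'rV[R]_n) ord0 j).
Proof.
apply: (measurability _ (RGenOpens.measurableE R)) => _ [_ [a [b ->] <-]].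
rewrite setTI; apply: sub_sigma_algebra.
apply: (open_comp (f := fun x : 'rV[R]_n => x ord0 j)); last exact: interval_open.
by move=> x _; exact: coord_continuous.
Qed.

Lemma measurable_cons_rV n : measurable_fun setT
  (@cons_rV R n : measurableTypeR R * borelRn R n -> borelRn R n.+1).
Proof.
apply: measurable_fun_rV => j.
case: (split_ordP (j : 'I_(1 + n))) => k ->.
  rewrite (_ : (fun _ => _) = fst); first exact: measurable_fst.
  apply/funext => x; rewrite [LHS](row_mxEl (x.1)%:M (x.2 : 'rV[R]_n)).
  by rewrite mxE (ord1 k) eqxx.
rewrite (_ : (fun _ => _) =
    (fun x : borelRn R n => (x : 'rV[R]_n) ord0 k) \o snd).
  exact: measurableT_comp (measurable_coord _) (measurable_snd).
by apply/funext => x; rewrite [LHS](row_mxEr (x.1)%:M (x.2 : 'rV[R]_n)).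
Qed.

Let uncons_rV n (x : borelRn R n.+1) : measurableTypeR R * borelRn R n :=
  ((x : 'rV[R]_n.+1) ord0 ord0, \row_j (x : 'rV[R]_n.+1) ord0 (lift ord0 j)).

Let cons_rVK n : cancel (@cons_rV R n) (@uncons_rV n).
Proof.
move=> [a v]; rewrite /cons_rV /uncons_rV /=; congr pair.
  rewrite (_ : ord0 = lshift n (@ord0 0)); last exact: val_inj.
  by rewrite [LHS](row_mxEl a%:M (v : 'rV[R]_n)) mxE eqxx.
apply/rowP => j; rewrite mxE (_ : lift ord0 j = rshift 1 j); last exact: val_inj.
by rewrite [LHS](row_mxEr a%:M (v : 'rV[R]_n)).
Qed.

Let measurable_uncons_rV n : measurable_fun setT (@uncons_rV n).
Proof.
apply: measurable_fun_pair; first exact: (measurable_coord (n := n.+1)).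
apply: measurable_fun_rV => j; under eq_fun do rewrite mxE.
exact: (measurable_coord (n := n.+1)).
Qed.

Let borel_lebesgue_spec n :
  exists m : {sigma_finite_measure set (borelRn R n) -> \bar R},
    borel_lebesgue R n = m.
Proof.
elim: n => [|n [m mE]]; first by exists (\d_(0 : borelRn R 0)).
have mc := @measurable_cons_rV n.
pose f : measurableTypeR R * borelRn R n -> borelRn R n.+1 := @cons_rV R n.
pose lm : {sigma_finite_measure set (measurableTypeR R) -> \bar R} :=
  @lebesgue_measure R.
pose q : set (borelRn R n.+1) -> \bar R :=
  pushforward (product_measure1 lm m) f.
have q0 : q set0 = 0%E by rewrite /q /pushforward preimage_set0 measure0.
have q_ge0 A : (0 <= q A)%E by exact: measure_ge0.
have q_add : semi_sigma_additive q.
  move=> F mF tF mUF; rewrite /q /pushforward preimage_bigcup.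
  apply: measure_semi_sigma_additive.
  - by move=> k; rewrite -[X in measurable X]setTI; exact: mc.
  - apply/trivIsetP => /= i j _ _ ij; rewrite -preimage_setI.
    by move/trivIsetP : tF => /(_ _ _ _ _ ij) ->//; rewrite preimage_set0.
  - by rewrite -preimage_bigcup -[X in measurable X]setTI; exact: mc.
have q_sigma : sigma_finite setT q.
  have [F FT Foo] : sigma_finite setT (product_measure1 lm m).
    have /sigma_finiteP[F [TF ndF Foo]] := sigma_finiteT lm.
    have /sigma_finiteP[G [TG ndG Goo]] := sigma_finiteT m.
    exists (fun k => F k `*` G k).
      rewrite -setXTT TF TG predeqE => -[x y]; split.
        move=> [/= [i _ Fix] [j _ Gjy]]; exists (maxn i j) => //; split.
        - by move: x Fix; exact/subsetPset/ndF/leq_maxl.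
        - by move: y Gjy; exact/subsetPset/ndG/leq_maxr.
      by move=> [i _ []/= ? ?]; split; exists i.
    move=> k; have [? ?] := Foo k; have [? ?] := Goo k.
    split; first exact: measurableX.
    by rewrite product_measure1E// lte_mul_pinfty// ge0_fin_numE.
  exists (fun k => @uncons_rV n @^-1` F k).
    by rewrite -preimage_bigcup -FT preimage_setT.
  move=> k; have [mF Fk] := Foo k; split.
    by rewrite -[X in measurable X]setTI; exact: measurable_uncons_rV.
  rewrite /q /pushforward -comp_preimage (_ : _ \o _ = id) ?preimage_id//.
  by apply/funext => x; exact: cons_rVK.
pose i1 := isMeasure.Build _ _ _ q q0 q_ge0 q_add.
pose q1 : measure _ _ := HB.pack q i1.
pose i2 := Measure_isSigmaFinite.Build _ _ _ q1 q_sigma.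
pose q2 : {sigma_finite_measure set (borelRn R n.+1) -> \bar R} :=
  HB.pack q i1 i2.
by exists q2; rewrite /= mE.
Qed.

Let borel_lebesgue0 n : borel_lebesgue R n set0 = 0%E.
Proof. by have [m ->] := borel_lebesgue_spec n; rewrite measure0. Qed.

Let borel_lebesgue_ge0 n A : (0 <= borel_lebesgue R n A)%E.
Proof. by have [m ->] := borel_lebesgue_spec n. Qed.

Let borel_lebesgue_semi_sigma_additive n :
  semi_sigma_additive (borel_lebesgue R n).
Proof.
have [m ->] := borel_lebesgue_spec n; exact: measure_semi_sigma_additive.
Qed.

HB.instance Definition _ n := isMeasure.Build _ _ _ (borel_lebesgue R n)
  (borel_lebesgue0 n) (@borel_lebesgue_ge0 n)
  (@borel_lebesgue_semi_sigma_additive n).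

Let borel_lebesgue_sigma_finite n : sigma_finite setT (borel_lebesgue R n).
Proof. have [m ->] := borel_lebesgue_spec n; exact: sigma_finiteT. Qed.

HB.instance Definition _ n := Measure_isSigmaFinite.Build _ _ _
  (borel_lebesgue R n) (borel_lebesgue_sigma_finite n).

Lemma borel_lebesgue_box n (a b : 'rV[R]_n) :
  (forall j, a ord0 j <= b ord0 j) ->
  borel_lebesgue R n
    [set x | forall j, a ord0 j <= (x : 'rV[R]_n) ord0 j <= b ord0 j]
  = (\prod_(j < n) (b ord0 j - a ord0 j))%:E.
Proof.
elim: n a b => [|n IHn] a b ab.
  by rewrite big_ord0 /= diracE mem_set //= => -[].
pose box (a b : 'rV[R]_n) : set (borelRn R n) :=
  [set x | forall j, a ord0 j <= (x : 'rV[R]_n) ord0 j <= b ord0 j].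
have mbox (c d : 'rV[R]_n) : measurable (box c d).
  rewrite (_ : box c d = \bigcap_(j in [set: 'I_n])
      ((fun x : borelRn R n => (x : 'rV[R]_n) ord0 j) @^-1`
        `[c ord0 j, d ord0 j]%classic)).
    apply: fin_bigcap_measurable; first exact: finite_finset.
    move=> j _; rewrite -[X in measurable X]setTI.
    by apply: (measurable_coord j) => //; exact: measurable_itv.
  apply/seteqP; split => [x xcd j _ /=|x xcd j]; first by rewrite in_itv /= xcd.
  by have := xcd j I; rewrite /= in_itv.
pose tl (v : 'rV[R]_n.+1) : 'rV[R]_n := \row_j v ord0 (lift ord0 j).
rewrite /= /pushforward.
rewrite [X in product_measure1 _ _ X](_ : _ =
    `[a ord0 ord0, b ord0 ord0]%classic `*` box (tl a) (tl b)); last first.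
  apply/seteqP; split => [[y v] /= yv|[y v] /= []].
    rewrite in_itv /= ; split => [|j].
      have := yv ord0; have /(congr1 fst)/= := cons_rVK (y, v).
      by rewrite /uncons_rV /= => ->.
    have := yv (lift ord0 j); have /(congr1 snd)/= := cons_rVK (y, v).
    by rewrite !mxE => <-; rewrite mxE.
  rewrite in_itv /= => yab vab j.
  case: (unliftP ord0 j) => [k|] ->.
    have := vab k; have /(congr1 snd)/rowP/(_ k) := cons_rVK (y, v).
    by rewrite !mxE /= => ->.
  by have /(congr1 fst)/= -> := cons_rVK (y, v).
rewrite product_measure1E; [|exact: measurable_itv|exact: mbox].
rewrite big_ord_recl EFinM; congr (_ * _)%E.
  rewrite [LHS](lebesgue_measure_itv `[a ord0 ord0, b ord0 ord0]) /= lte_fin.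
  have := ab ord0; rewrite le_eqVlt => /orP[/eqP->|->//].
  by rewrite ltxx subrr.
rewrite [LHS](IHn (tl a) (tl b)) => [|j]; last by rewrite !mxE.
by congr EFin; apply: eq_bigr => j _; rewrite !mxE.
Qed.

End borel_lebesgue_measure.

(* R^n with its Lebesgue sigma-algebra, and Lebesgue measure on it, obtained by
   Caratheodory completion exactly as completed_lebesgue_measure is on R. *)
Notation lebRn R n := (caratheodory_type ((borel_lebesgue R n)^*)%mu).

Definition lebesgueRn (R : realType) (n : nat) : set (lebRn R n) -> \bar R :=
  @completed_measure_extension _ _ _ (borel_lebesgue R n).
HB.instance Definition _ (R : realType) (n : nat) :=
  Measure.on (@lebesgueRn R n).

Notation borel_lebesgue2 R n :=
  (product_measure1 (borel_lebesgue R n) (borel_lebesgue R n)).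
Notation lebRn2 R n := (caratheodory_type ((borel_lebesgue2 R n)^*)%mu).

(* Lebesgue measure on R^n x R^n = R^(2n). *)
Definition lebesgueRn2 (R : realType) (n : nat) : set (lebRn2 R n) -> \bar R :=
  @completed_measure_extension _ _ _ (borel_lebesgue2 R n).
HB.instance Definition _ (R : realType) (n : nat) :=
  Measure.on (@lebesgueRn2 R n).

Arguments lebesgueRn : clear implicits.
Arguments lebesgueRn2 : clear implicits.

Definition kernel_mass (R : realType) (n : nat) (K : 'rV[R]_n -> 'rV[R]_n -> R)
    (A : set 'rV[R]_n) (x : 'rV[R]_n) : \bar R :=
  (\int[lebesgueRn R n]_(y in A) (K x y)%:E)%E.

(* Joint Lebesgue measurability only makes almost every slice K(x, .)
   measurable; kernel_slice states that \int K(x, y) dy makes sense for every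
   x in B_1, as is implicit in taking a supremum over all x. *)
Record admissible_kernel (R : realType) (n : nat)
    (K : 'rV[R]_n -> 'rV[R]_n -> R) : Prop := AdmissibleKernel {
  kernel_ge0 : forall x y, eball 1 x -> eball 1 y -> 0 <= K x y;
  kernel_integrable : (lebesgueRn2 R n).-integrable
    (eball 1 `*` eball 1 : set (lebRn2 R n)) (fun z => (K z.1 z.2)%:E);
  kernel_slice : forall x, eball 1 x ->
    measurable_fun (eball 1 : set (lebRn R n)) (K x);
  kernel_mass_bounded :
    (ereal_sup [set kernel_mass K (eball 1) x | x in eball 1] < +oo)%E }.

(* u is total; only its values on the closed ball and for t >= 0 matter. *)
Record classical (R : realType) (n : nat) (u : 'rV[R]_n -> R -> R) : Prop :=
  Classical {
  classical_continuous :
    {within closure (eball 1) `*` `[0, +oo[,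
      continuous (fun z : 'rV[R]_n * R => u z.1 z.2)};
  classical_C1_time : forall x, eball 1 x ->
    (forall t, 0 < t -> derivable (u x) t 1) /\
    {in `]0, +oo[, continuous (derive1 (u x))};
  classical_C2_space : forall t, 0 < t ->
    C2_on (eball 1) (fun x => u x t) }.

Definition solves_equation (R : realType) (n : nat) (c Theta : R)
    (K : 'rV[R]_n -> 'rV[R]_n -> R) (u : 'rV[R]_n -> R -> R) : Prop :=
  forall x t, eball 1 x -> 0 < t ->
    (derive1 (u x) t)%:E =
      ((c * laplacian (fun z => u z t) x)%:E +
       \int[lebesgueRn R n]_(y in eball 1)
         (Num.max (u y t - Theta) 0 * K x y)%:E)%E.

(* Main.v *)
Require Import Defs.
From mathcomp Require Import all_boot all_order all_algebra.
From mathcomp Require Import all_classical all_reals all_analysis.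
From mathcomp Require Import measurable_realfun ring lra.
Import Order.TTheory GRing.Theory Num.Theory.
Import numFieldNormedType.Exports.
Local Open Scope classical_set_scope.
Local Open Scope ring_scope.

(** The function v(x,t) = lambda0 * exp(alpha t) * (1 - |x|^2) is a strict
subsolution when alpha and c are small, and the theorem is the comparison of a
solution u with v.

Strictness: its Laplacian is the constant -2 n lambda0 exp(alpha t) and its
time derivative is at most alpha lambda0 exp(alpha t).  On a small ball B_r one
has v - Theta >= d exp(alpha t) with d = (lambda0 - Theta) / 2, because
exp(alpha t) >= 1; hence the reaction term of v is at least d m exp(alpha t),
where m > 0 is a lower bound of the mass that K gives to B_r.  It therefore
suffices that (alpha + 2 n c) lambda0 < d m.  All three terms grow at the same
exponential rate, which is why one choice of alpha and c serves for all times.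

Comparison ([barrier_le]): let M bound the masses of K from above, and minimise
exp(-M t) (u - v) over the compact cylinder over [0, T]
([weighted_difference_min]).  If the minimum is negative, it is attained at an
interior point x0 and at a time t0 > 0, since u >= v on the parabolic boundary.
Write -eta = (u - v)(x0, t0) < 0 and E = exp(alpha t0).  There

- the time derivative gives u_t <= v_t - M eta ([derive1_le_at_weighted_min]);
- the second derivative test gives Lap u >= Lap v ([laplacian_ge_at_min]);
- x0 is a spatial minimum of u - v, so u - Theta >= d E - eta on B_r and the
  reaction term is at least (d E - eta) k, where m <= k <= M is the mass that
  K(x0, .) gives to B_r ([reaction_lower_bound]).

The loss eta k in the last item is absorbed by M eta in the first, and what
remains contradicts the strict inequality for v.  The weight exp(-M t) is what
lets the nonlocal term, which is only Lipschitz in u, be treated like a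
zeroth-order term of arbitrary sign. *)

(** * Derivative tests on the line *)
(** Only points to the left of [t] are compared, so that a minimum at the final
time of a cylinder is covered. *)
Lemma derive1_le0_at_left_min (R : realType) (f : R -> R) (t e : R) :
  0 < e -> derivable f t 1 -> (forall s, t - e < s < t -> f t <= f s) ->
  derive1 f t <= 0.
Proof.
move=> e0 df fmin; rewrite derive1E /derive cvg_at_leftE//.
apply: limr_le; first exact: cvgP (cvg_dnbhs_at_left df).
near=> h.
have h0 : h < 0 by near: h; exact: nbhs_left_lt.
rewrite nmulr_rle0 ?invr_lt0// subr_ge0 (_ : h *: 1 = h); last exact: mulr1.
apply: fmin; rewrite gtrDr h0 andbT [ltRHS]addrC ltrD2l.
by near: h; apply: nbhs_left_gt; rewrite oppr_lt0.
Unshelve. all: by end_near. Qed.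

(** If [l] were negative, then [f'], which vanishes at the minimum, would be
negative just to the right of 0, and [f] would decrease there by the mean value
theorem.  The derivatives are given as functions so that [f'] can be a
directional derivative restricted to a line. *)
Lemma second_derivative_test (R : realType) (f f' : R -> R) (l e : R) :
  0 < e -> (forall s : R, `|s| < e -> is_derive s 1 f (f' s)) ->
  is_derive (0:R) 1 f' l -> (forall s : R, `|s| < e -> f 0 <= f s) -> 0 <= l.
Proof.
move=> e0 df [df' <-] fmin; rewrite leNgt; apply/negP => l0.
have f'0 : f' 0 = 0.
  have d0 : is_derive (0:R) 1 f 0.
    apply: (@derive1_at_min _ f (- e) e) => [|s||s]; rewrite ?in_itv/=.
    - by rewrite ge0_cp// ltW.
    - by rewrite -ltr_norml => /df[].
    - by rewrite oppr_lt0 e0.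
    - by rewrite -ltr_norml => /fmin.
  have : is_derive (0:R) 1 f (f' 0) by apply: df; rewrite normr0.
  by move=> /@derive_val <-; rewrite (@derive_val _ _ _ _ _ _ _ d0).
have neg : \forall s \near (0:R)^'+, f' s < 0.
  have := cvg_dnbhs_at_right df'.
  move=> /cvgr_lt /(_ _ l0); apply: filter_app; near=> h.
  have h0 : 0 < h by near: h; exact: nbhs_right_gt.
  by rewrite f'0 subr0/= addr0 pmulr_rlt0 ?invr_gt0// [h *: 1]mulr1.
(* the same with an explicit radius, as the mean value theorem needs it *)
have [r r0 {}neg] : exists2 r : R, 0 < r & forall s, 0 < s < r -> f' s < 0.
  move: neg; rewrite near_withinE => /nbhs_ballP[r /= r0 rP]; exists r => // s.
  move=> /andP[s0 sr]; apply: rP => //.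
  by rewrite /ball/= sub0r normrN gtr0_norm.
pose d := Num.min e r / 2.
have m0 : 0 < Num.min e r by rewrite lt_min e0.
have d0 : 0 < d by rewrite divr_gt0.
have dm : d < Num.min e r by rewrite ltr_pdivrMr// ltr_pMr// ltr1n.
move: (dm); rewrite lt_min => /andP[de dr].
have [s s0d fs] : exists2 s, s \in `]0, d[ & f d - f 0 = f' s * (d - 0).
  apply: MVT => // [s|].
    rewrite in_itv/= => /andP[s0 sd]; apply: df.
    by rewrite gtr0_norm// (lt_trans sd).
  apply: derivable_within_continuous => s; rewrite in_itv/= => /andP[s0 sd].
  by have [] : is_derive s 1 f (f' s)
    by apply: df; rewrite ger0_norm// (le_lt_trans sd).
move: s0d; rewrite in_itv/= => /andP[s0 sd].
have : f 0 <= f d by apply: fmin; rewrite gtr0_norm.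
rewrite -subr_ge0 fs subr0 pmulr_lge0// leNgt neg// s0/=.
exact: lt_trans dr.
Unshelve. all: by end_near. Qed.

Lemma is_derive_line (R : realType) (V : normedModType R) (f : V -> R)
    (x v : V) (s : R) :
  derivable f (x + s *: v) v ->
  is_derive s 1 (fun s => f (x + s *: v)) ('D_v f (x + s *: v)).
Proof.
have E :
   (fun h : R => h^-1 *: (f (x + (h *: 1 + s) *: v) - f (x + s *: v))) =
   (fun h : R => h^-1 *: (f (h *: v + (x + s *: v)) - f (x + s *: v))).
  apply/funext => h; congr (_ *: (f _ - _)).
  by rewrite [h *: 1]mulr1 scalerDl addrCA.
move=> df; apply: DeriveDef.
  by move: df; rewrite /derivable /= -E.
by rewrite /derive /= E.
Qed.

Lemma is_derive_quadratic (R : realType) (a b c s : R) :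
  is_derive s 1 (fun t => a + b * t + c * t ^+ 2) (b + 2 * c * s).
Proof.
have := is_derive_poly (a%:P + b *: 'X + c *: 'X^2) s.
rewrite !(derivD, derivZ, derivC, derivX, derivXn) !hornerE.
rewrite (_ : _ + _ * (s + s) = b + 2 * c * s); last by ring.
by congr is_derive; apply/funext => t; rewrite !hornerE.
Qed.

Lemma is_derive_expRM (R : realType) (a t : R) :
  is_derive t 1 (fun s => expR (a * s)) (a * expR (a * t)).
Proof.
have lin : is_derive t 1 (fun s : R => a * s) a.
  have := is_derive_quadratic R 0 a 0 t.
  rewrite (_ : a + 2 * 0 * t = a); last by ring.
  by congr is_derive; apply/funext => s; ring.
by rewrite mulrC; exact: (is_derive1_comp (is_derive_expR _) lin).
Qed.

(** * Euclidean balls and interior minima *)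

Section euclidean.
Context (R : realType) (n : nat).
Implicit Types x y : 'rV[R]_n.

Lemma enorm_ge0 x : 0 <= enorm x. Proof. exact: sqrtr_ge0. Qed.

Lemma enorm_sqr x : enorm x ^+ 2 = \sum_(i < n) x 0 i ^+ 2.
Proof. by rewrite sqr_sqrtr// sumr_ge0// => i _; exact: sqr_ge0. Qed.

Lemma normr_coord_le_enorm x i : `|x 0 i| <= enorm x.
Proof.
rewrite -(@ler_pXn2r _ 2)// ?nnegrE ?enorm_ge0// enorm_sqr real_normK ?num_real//.
by rewrite (bigD1 i)//= lerDl sumr_ge0// => j _; exact: sqr_ge0.
Qed.

Lemma enorm_sqr_line x i (s : R) :
  enorm (x + s *: basis_vec R i) ^+ 2 = enorm x ^+ 2 + 2 * x 0 i * s + s ^+ 2.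
Proof.
rewrite !enorm_sqr (bigD1 i)//= [in RHS](bigD1 i)//= !mxE !eqxx mulr1.
under eq_bigr => j ji do rewrite !mxE (negbTE ji) andbF mulr0 addr0.
by ring.
Qed.

Lemma enorm_continuous : continuous (@enorm R n).
Proof.
move=> x; apply: (@continuous_comp _ _ _
  (fun x : 'rV[R]_n => \sum_(i < n) x 0 i ^+ 2) Num.sqrt);
  last exact: sqrt_continuous.
apply: continuous_big => [|i _ y]; first exact: add_continuous.
by apply: (@continuousM _ _ (fun y : 'rV[R]_n => y 0 i) (fun y => y 0 i));
  exact: coord_continuous.
Qed.

Lemma eball_open r : open (@eball R n r).
Proof.
rewrite (_ : eball r = @enorm R n @^-1` [set s | s < r])//.
apply: open_comp; last exact: open_lt.
by move=> x _; exact: enorm_continuous.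
Qed.

Lemma closure_eball_le x : closure (eball 1) x -> enorm x <= 1.
Proof.
have cl1 : closed [set x : 'rV[R]_n | enorm x <= 1].
  rewrite (_ : mkset _ = @enorm R n @^-1` [set s | s <= 1])//.
  apply: closed_comp; last exact: closed_le.
  by move=> y _; exact: enorm_continuous.
move: x; rewrite -/(subset _ [set x | enorm x <= 1]).
rewrite [X in _ `<=` X](closure_id _).1//.
by apply: closureS => y; exact: ltW.
Qed.

Lemma eball1P x : eball 1 x <-> enorm x ^+ 2 < 1.
Proof. by rewrite /eball/= expr_lt1 ?enorm_ge0. Qed.

Lemma closure_eball_compact : compact (closure (@eball R n 1)).
Proof.
have cube : compact [set v : 'rV[R]_n | forall i, v ord0 i \in `[-1, 1]%R].
  apply: (@rV_compact R _ (fun=> `[-1, 1]%classic : set R)) => _.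
  exact: segment_compact.
apply: (subclosed_compact _ cube); first exact: closed_closure.
move=> x /closure_eball_le x1 i /=; rewrite in_itv/= -ler_norml.
exact: le_trans (normr_coord_le_enorm _ _) x1.
Qed.

Lemma boundary_eball x : closure (eball 1) x -> ~ eball 1 x ->
  boundary (eball 1) x.
Proof. by move=> cx nx; split => // /interior_subset. Qed.

Lemma measurable_eball r : measurable (eball r : set (lebRn R n)).
Proof.
apply: sub_caratheodory; apply: sub_sigma_algebra.
by apply: sub_sigma_algebra; exact: eball_open.
Qed.

(** The profile A (1 - |x|^2) has pure second derivatives -2A, so the second
derivative test along each coordinate line through the minimum gives -2A as a
lower bound of each term of the Laplacian. *)
Lemma laplacian_ge_at_min (f : 'rV[R]_n -> R) x (A : R) :
  C2_on (eball 1) f -> eball 1 x ->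
  (forall y, eball 1 y ->
    f x - A * (1 - enorm x ^+ 2) <= f y - A * (1 - enorm y ^+ 2)) ->
  - (2 * n%:R * A) <= laplacian f x.
Proof.
move=> [C1f C2f] x1 xmin.
have /= : \sum_(i < n) - (2 * A) <= laplacian f x; last first.
  by rewrite sumr_const card_ord -mulr_natr; congr (_ <= _); ring.
apply: ler_sum => i _.
have [e e0 e1] : exists2 e : R, 0 < e &
    forall s, `|s| < e -> eball 1 (x + s *: basis_vec R i).
  have /eball1P x1' := x1.
  (* for |s| < 1, moving by s changes the squared norm by at most 3 |s| *)
  exists (Num.min 1 ((1 - enorm x ^+ 2) / 3)).
    by rewrite lt_min ltr01 divr_gt0// subr_gt0.
  move=> s; rewrite lt_min => /andP[s1 sx]; apply/eball1P.
  rewrite enorm_sqr_line.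
  have : x 0 i * s <= `|s|.
    rewrite (le_trans (ler_norm _))// normrM ler_piMl//.
    exact: le_trans (normr_coord_le_enorm _ _) (ltW x1).
  have : s ^+ 2 <= `|s|.
    by rewrite -real_normK ?num_real// expr2 ler_piMl// ltW.
  by move: sx; rewrite ltr_pdivlMr//; lra.
rewrite lerNl -subr_ge0 opprK.
apply: (@second_derivative_test R
  (fun s => f (x + s *: basis_vec R i)
            + A * enorm (x + s *: basis_vec R i) ^+ 2)
  (fun s => 'D_(basis_vec R i) f (x + s *: basis_vec R i)
            + A * (2 * x 0 i + 2 * s)) _ e) => //.
- move=> s /e1 xs.
  have fs := is_derive_line _ _ _ _ _ _ ((C1f i).1 _ xs).
  under eq_fun do rewrite enorm_sqr_line.
  have qs := is_derive_quadratic R (A * enorm x ^+ 2) (A * (2 * x 0 i)) A s.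
  have := is_deriveD fs qs.
  rewrite (_ : A * _ + 2 * A * s = A * (2 * x 0 i + 2 * s)); last by ring.
  by congr is_derive; apply/funext => r; rewrite !fctE; ring.
- have x1' : eball 1 (x + 0 *: basis_vec R i) by rewrite scale0r addr0.
  have fs := is_derive_line _ _ _ _ _ _ (((C2f i) i).1 _ x1').
  have qs := is_derive_quadratic R (A * (2 * x 0 i)) (A * 2) 0 0.
  have := is_deriveD fs qs.
  rewrite scale0r addr0.
  rewrite (_ : _ + _ = 2 * A + 'D_(basis_vec R i) ('D_(basis_vec R i) f) x);
    last by ring.
  by congr is_derive; apply/funext => r; rewrite !fctE; ring.
- move=> s /e1 xs; rewrite scale0r addr0.
  have := xmin _ xs; lra.
Qed.
End euclidean.

(** * The nonlocal reaction term *)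

(** The integral of a nonnegative function is a supremum over the simple
functions below it, hence monotone for arbitrary functions; this spares the
measurability of the solution on the ball. *)
Lemma le_ge0_integral_without_measurability d (T : measurableType d)
    (R : realType) (mu : {measure set T -> \bar R}) (D E : set T) (f g : T -> \bar R) :
  D `<=` E -> (forall x, D x -> 0 <= f x)%E -> (forall x, E x -> 0 <= g x)%E ->
  (forall x, D x -> f x <= g x)%E ->
  (\int[mu]_(x in D) f x <= \int[mu]_(x in E) g x)%E.
Proof.
move=> DE f0 g0 fg; rewrite !ge0_integralE//.
apply: ereal_sup_le => _ [h hf <-]; exists h => // x; apply: (le_trans (hf x)).
rewrite !patchE; case: ifPn => [/set_mem Dx|_].
  by rewrite mem_set ?fg//; exact: DE.
by case: ifPn => // /set_mem; exact: g0.
Qed.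

Section kernel.
Context (R : realType) (n : nat) (K : 'rV[R]_n -> 'rV[R]_n -> R)
  (hK : admissible_kernel K).

Lemma kernel_mass_le (B : set 'rV[R]_n) x : B `<=` eball 1 -> eball 1 x ->
  (kernel_mass K B x <= kernel_mass K (eball 1) x)%E.
Proof.
move=> B1 x1; apply: le_ge0_integral_without_measurability => // y.
- by move=> /B1 y1; rewrite lee_fin; apply: kernel_ge0 hK _ _ _ _.
- by move=> y1; rewrite lee_fin; apply: kernel_ge0 hK _ _ _ _.
Qed.

(** This bound will be the rate of the exponential weight in the comparison, so
it must be real and hold for all points and all subsets at once. *)
Lemma kernel_mass_uniformly_bounded :
  exists M : R, forall (B : set 'rV[R]_n) x, B `<=` eball 1 -> eball 1 x ->
    (kernel_mass K B x <= M%:E)%E.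
Proof.
have Koo := kernel_mass_bounded hK.
have bnd B x : B `<=` eball 1 -> eball 1 x -> (kernel_mass K B x <=
    ereal_sup [set kernel_mass K (eball 1) x | x in eball 1])%E.
  move=> B1 x1; apply: (le_trans (kernel_mass_le B x B1 x1)).
  by apply: ereal_sup_ubound; exists x.
case: (ereal_sup _) Koo bnd => [M _ bnd|//|_ bnd]; first by exists M.
by exists 0 => B x B1 /(bnd _ _ B1)/le_trans; apply; rewrite leNye.
Qed.

(** The positive part of [w] is at least that of [a] on [B] and nonnegative
elsewhere.  Keeping the positive part of [a] lets one statement serve for either
sign of [a]. *)
Lemma reaction_lower_bound (B : set 'rV[R]_n) (w : 'rV[R]_n -> R) x (a : R) :
  measurable (B : set (lebRn R n)) -> B `<=` eball 1 -> eball 1 x ->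
  (forall y, B y -> a <= w y) ->
  ((Num.max a 0)%:E * kernel_mass K B x <=
   \int[lebesgueRn R n]_(y in eball 1) (Num.max (w y) 0 * K x y)%:E)%E.
Proof.
move=> mB B1 x1 aw.
have max0 (s : R) : 0 <= Num.max s 0 by rewrite le_max lexx orbT.
have K0 y : eball 1 y -> 0 <= K x y by exact: kernel_ge0 hK _ _ _.
rewrite /kernel_mass -ge0_integralZl_EFin//; last 2 first.
- by move=> y /B1 y1; rewrite lee_fin K0.
- apply/measurable_EFinP.
  apply: (measurable_funS (E := eball 1 : set (lebRn R n))) => //.
    exact: measurable_eball.
  exact: kernel_slice hK _ x1.
apply: le_ge0_integral_without_measurability => // y.
- by move=> /B1 y1; rewrite -EFinM lee_fin mulr_ge0// K0.
- by move=> y1; rewrite lee_fin mulr_ge0// K0.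
- move=> By; rewrite -EFinM lee_fin ler_wpM2r ?K0//; first exact: B1.
  by rewrite ge_max le_max aw//= max0.
Qed.

End kernel.

(** * Comparison with the barrier *)

Definition barrier {R : realType} {n : nat} (lambda alpha : R) (x : 'rV[R]_n)
  (t : R) : R := lambda * expR (alpha * t) * (1 - enorm x ^+ 2).

Lemma barrier_continuous (R : realType) (n : nat) (lambda alpha : R) :
  continuous (fun z : 'rV[R]_n * R => barrier lambda alpha z.1 z.2).
Proof.
move=> z; apply: (@continuousM _ _
   (fun z : 'rV[R]_n * R => lambda * expR (alpha * z.2))
   (fun z : 'rV[R]_n * R => 1 - enorm z.1 ^+ 2)).
  apply: (@continuousM _ _ (fun=> lambda)
    (fun z : 'rV[R]_n * R => expR (alpha * z.2))); first exact: cst_continuous.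
  apply: (@continuous_comp _ _ _ (fun z : 'rV[R]_n * R => alpha * z.2) expR);
    last exact: continuous_expR.
  by apply: (@continuousM _ _ (fun=> alpha) snd);
    [exact: cst_continuous|exact: cvg_snd].
apply: cvgB; first exact: cvg_cst.
apply: (@continuous_comp _ _ _ (fun z : 'rV[R]_n * R => enorm z.1)
  (fun s => s ^+ 2)); last exact: exprn_continuous.
apply: (@continuous_comp _ _ _ fst (@enorm R n)); first exact: cvg_fst.
exact: enorm_continuous.
Qed.

Lemma weighted_difference_min (R : realType) (n : nat)
    (u v : 'rV[R]_n -> R -> R) (M T : R) :
  {within closure (eball 1) `*` `[0, +oo[,
      continuous (fun z : 'rV[R]_n * R => u z.1 z.2)} ->
  continuous (fun z : 'rV[R]_n * R => v z.1 z.2) ->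
  0 <= T ->
  exists x0 t0, [/\ closure (eball 1) x0, 0 <= t0 <= T &
    forall x t, closure (eball 1) x -> 0 <= t <= T ->
      expR (- M * t0) * (u x0 t0 - v x0 t0) <=
      expR (- M * t) * (u x t - v x t)].
Proof.
move=> cu cv T0.
pose D : set ('rV[R]_n * R) := closure (eball 1) `*` `[0, T].
have cD : compact D.
  by apply: compact_setX; [exact: closure_eball_compact|exact: segment_compact].
have D0 : D !=set0.
  exists (0, 0); split => /=; last by rewrite in_itv/= lexx.
  apply: subset_closure; apply/eball1P; rewrite enorm_sqr big1 ?ltr01// => i _.
  by rewrite mxE expr0n.
pose F (z : 'rV[R]_n * R) :=
  expR (- M * z.2) * (u z.1 z.2 - v z.1 z.2).
have cF : {within D, continuous F}.
  move=> z; apply: (@continuousM R (subspace D)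
    (fun z : 'rV[R]_n * R => expR (- M * z.2))
    (fun z : 'rV[R]_n * R => u z.1 z.2 - v z.1 z.2) z).
    move: z; apply: continuous_subspaceT => z.
    apply: (@continuous_comp _ _ _ (fun z : 'rV[R]_n * R => - M * z.2) expR);
      last exact: continuous_expR.
    by apply: (@continuousM _ _ (fun=> - M) snd);
      [exact: cst_continuous|exact: cvg_snd].
  apply: (@continuousB R _ (subspace D) (fun z : 'rV[R]_n * R => u z.1 z.2)
     (fun z : 'rV[R]_n * R => v z.1 z.2)).
    move: z; apply: continuous_subspaceW cu => -[x0 t0] [/= cx].
    by rewrite !in_itv/= andbT => /andP[].
  by move: z; apply: continuous_subspaceT; exact: cv.
have [[x0 t0] /set_mem[/= x0D t0D] Fmin] := compact_EVT_min D0 cD cF.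
exists x0, t0; split => //.
move=> y s cy sT; apply: (Fmin (y, s)); exact/mem_set.
Qed.

(** The derivative of the weighted difference is nonpositive at its minimum; the
weight contributes the term with the factor [M]. *)
Lemma derive1_le_at_weighted_min (R : realType) (f : R -> R) (M B alpha t : R) :
  0 < t -> derivable f t 1 ->
  (forall s, 0 < s < t ->
     expR (- M * t) * (f t - B * expR (alpha * t)) <=
     expR (- M * s) * (f s - B * expR (alpha * s))) ->
  derive1 f t <=
    alpha * (B * expR (alpha * t)) + M * (f t - B * expR (alpha * t)).
Proof.
move=> t0 df fmin.
pose g s := expR (- M * s) * (f s - B * expR (alpha * s)).
pose dg := expR (- M * t) * (derive1 f t - alpha * (B * expR (alpha * t))
                             - M * (f t - B * expR (alpha * t))).
have gt : is_derive t 1 g dg.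
  have f' : is_derive t 1 f (derive1 f t) by rewrite derive1E; exact: derivableP.
  have e1 := is_derive_expRM _ (- M) t.
  have e2 := is_derive_expRM _ alpha t.
  have := is_deriveM e1 (is_deriveB f' (is_deriveZ B e2)).
  rewrite (_ : _ *: _ + _ *: _ = dg); last first.
    transitivity
      (expR (- M * t) * (derive1 f t - B * (alpha * expR (alpha * t))) +
       (f t - B * expR (alpha * t)) * (- M * expR (- M * t))); first by [].
    by rewrite /dg; ring.
  by [].
have : derive1 g t <= 0.
  apply: (@derive1_le0_at_left_min _ _ _ t) => // s; rewrite subrr => st.
  exact: fmin.
rewrite derive1E (@derive_val _ _ _ _ _ _ _ gt) pmulr_rle0 ?expR_gt0//.
lra.
Qed.

(** Comparison with the strict subsolution.  The number [d] is the height of the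
profile above the threshold on the ball of radius [r], and [gap] is the
strictness: after division by the common factor expR (alpha * t), it says that
growth and diffusion of the barrier cost less than the reaction supplies.  A
negative minimum of the difference, weighted by expR (- M * t), is excluded;
the weight rate [M] only has to dominate the masses of [K]. *)
Lemma barrier_le (R : realType) (n : nat) (K : 'rV[R]_n -> 'rV[R]_n -> R)
    (hK : admissible_kernel K) (lambda Theta c alpha m r d : R)
    (Theta0 : 0 < Theta) (lambda0 : 0 < lambda) (c0 : 0 < c)
    (alpha0 : 0 <= alpha) (m0 : 0 < m) (d0 : 0 < d)
    (gap : (alpha + 2 * n%:R * c) * lambda < d * m)
    (r_level : Theta + d <= lambda * (1 - r ^+ 2))
    (m_mass : forall x, eball 1 x ->
      (m%:E <= kernel_mass K (eball r `&` eball 1) x)%E)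
    (u : 'rV[R]_n -> R -> R) :
  classical u -> solves_equation c Theta K u ->
  (forall x t, boundary (eball 1) x -> 0 <= t -> u x t = 0) ->
  (forall x, eball 1 x -> lambda * (1 - enorm x ^+ 2) <= u x 0) ->
  forall x t, eball 1 x -> 0 <= t -> barrier lambda alpha x t <= u x t.
Proof.
move=> [cu utime uspace] eqn ubd uinit x T x1 T0.
have [M MK] := kernel_mass_uniformly_bounded _ _ _ hK.
have [x0 [t0 [cx0 t0T umin]]] := @weighted_difference_min
  R n u (barrier lambda alpha) M T cu (@barrier_continuous R n lambda alpha) T0.
have /andP[t0_ge0 t0leT] := t0T.
rewrite leNgt; apply/negP => uT.
have w0 : u x0 t0 - barrier lambda alpha x0 t0 < 0.
  have := umin x T (subset_closure x1); rewrite T0 lexx => /(_ isT) le0.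
  rewrite -(pmulr_rlt0 _ (expR_gt0 (- M * t0))) (le_lt_trans le0)//.
  by rewrite pmulr_rlt0 ?expR_gt0// subr_lt0.
have x01 : eball 1 x0.
  apply: contrapT => nx0; move: w0; rewrite ubd//; last exact: boundary_eball.
  rewrite sub0r oppr_lt0 ltNge; apply/negP/negPn.
  apply: mulr_ge0_le0; first by rewrite mulr_ge0 ?expR_ge0// ltW.
  rewrite subr_le0.
  by rewrite leNgt; apply/negP => /eball1P.
have t0_gt0 : 0 < t0.
  rewrite lt_neqAle t0_ge0 andbT eq_sym; apply/negP => /eqP t00; move: w0.
  rewrite t00 /barrier mulr0 expR0 mulr1 subr_lt0 ltNge.
  by rewrite uinit.
have time : derive1 (u x0) t0 <=
    alpha * (lambda * (1 - enorm x0 ^+ 2) * expR (alpha * t0)) +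
    M * (u x0 t0 - lambda * (1 - enorm x0 ^+ 2) * expR (alpha * t0)).
  apply: derive1_le_at_weighted_min => //; first exact: (utime _ x01).1.
  move=> s /andP[s0 st].
  have bE q : lambda * (1 - enorm x0 ^+ 2) * expR (alpha * q) =
      barrier lambda alpha x0 q by rewrite /barrier mulrAC.
  rewrite !bE; apply: umin => //.
  by rewrite ltW//= (le_trans (ltW st)).
set E := expR (alpha * t0).
have E1 : 1 <= E.
  by apply: le_trans (expR_ge1Dx _); rewrite lerDl mulr_ge0.
have wmin y : eball 1 y -> u x0 t0 - barrier lambda alpha x0 t0 <=
    u y t0 - barrier lambda alpha y t0.
  move=> y1; have := umin y t0 (subset_closure y1) t0T.
  by rewrite ler_pM2l ?expR_gt0.
have lap : - (2 * n%:R * (lambda * E)) <= laplacian (fun z => u z t0) x0.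
  by apply: laplacian_ge_at_min => //; exact: uspace.
(* a lower bound of u - Theta on the ball of radius r, possibly negative *)
pose h := E * d + (u x0 t0 - barrier lambda alpha x0 t0).
have hle y : (eball r `&` eball 1) y -> h <= u y t0 - Theta.
  move=> [yr y1]; have := wmin y y1.
  suff : E * d + Theta <= barrier lambda alpha y t0 by rewrite /h; lra.
  have sq : enorm y ^+ 2 <= r ^+ 2.
    by rewrite lerXn2r ?nnegrE ?enorm_ge0// ltW// (le_lt_trans _ yr)// enorm_ge0.
  rewrite /barrier -/E.
  have : E * (Theta + d) <= E * (lambda * (1 - enorm y ^+ 2)).
    rewrite ler_pM2l ?expR_gt0// (le_trans r_level)// ler_pM2l//; lra.
  have : Theta <= E * Theta by rewrite ler_peMl// ltW.
  lra.
have mB : measurable (eball r `&` eball 1 : set (lebRn R n)).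
  by apply: measurableI; exact: measurable_eball.
have := reaction_lower_bound _ _ _ hK _ _ x0 h mB (@subIsetr _ _ _) x01 hle.
have := eqn x0 t0 x01 t0_gt0.
have := m_mass _ x01.
have := MK (eball r `&` eball 1) x0 (@subIsetr _ _ _) x01.
case: (kernel_mass _ _ _) => [k||//]; last by rewrite leye_eq.
case: (integral _ _ _) => [I||]//.
rewrite -EFinM !lee_fin => kM mk [utE] react.
have k0 : 0 <= k by rewrite (le_trans (ltW m0)).
have hk : h * k <= I.
  by rewrite (le_trans _ react)// ler_wpM2r// le_max lexx.
have clap := ler_wpM2l (ltW c0) lap.
have kEd : E * d * m <= E * d * k by rewrite ler_pM2l// mulr_gt0// expR_gt0.
(* the deficit is negative, so k <= M makes the left side the smaller one *)
have kw : M * (u x0 t0 - barrier lambda alpha x0 t0) <=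
    k * (u x0 t0 - barrier lambda alpha x0 t0).
  by rewrite ler_nM2r.
have Egap : E * ((alpha + 2 * n%:R * c) * lambda) < E * (d * m).
  by rewrite ltr_pM2l// expR_gt0.
have growth :
    alpha * (lambda * (1 - enorm x0 ^+ 2) * E) <= alpha * (lambda * E).
  rewrite ler_wpM2l// ler_wpM2r ?expR_ge0//; apply: ler_piMr; first exact: ltW.
  by rewrite gerBl sqr_ge0.
have wE : u x0 t0 - lambda * (1 - enorm x0 ^+ 2) * E =
    u x0 t0 - barrier lambda alpha x0 t0.
  by rewrite /barrier mulrAC.
move: time; rewrite utE -/E wE.
move: hk; rewrite /h => hk.
set w := u x0 t0 - _ in kw w0 hk *.
lra.
Qed.
(** * Divergence and the choice of the constants *)

(** An affine minorant of the exponential is enough. *)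
Lemma cvgry_expR_minorant (R : realType) (f : R -> R) (a b : R) :
  0 < a -> 0 < b -> (forall t, 0 <= t -> b * expR (a * t) <= f t) ->
  f t @[t --> +oo] --> +oo.
Proof.
move=> a0 b0 bf; apply/cvgryPge => A; near=> t.
have t0 : 0 <= t by near: t; apply: nbhs_pinfty_ge; exact: num_real.
apply: le_trans (bf _ t0).
have tA : A / (b * a) <= t.
  by near: t; apply: nbhs_pinfty_ge; exact: num_real.
have : b * (1 + a * t) <= b * expR (a * t) by rewrite ler_pM2l// expR_ge1Dx.
apply: le_trans; move: tA; rewrite ler_pdivrMr ?mulr_gt0//; lra.
Unshelve. all: by end_near. Qed.

Theorem theorem2p3 (R : realType) (n : nat) (hn : (0 < n)%N)
    (K : 'rV[R]_n -> 'rV[R]_n -> R) (hK : admissible_kernel K)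
    (lambda0 Theta : R) (hTheta : 0 < Theta) (hlambda0 : Theta < lambda0)
    (hKinf : forall r : R, 0 < r ->
      (0 < ereal_inf [set kernel_mass K (eball r `&` eball 1) x
                     | x in eball 1])%E) :
  exists cbar alpha : R, 0 < cbar /\ 0 < alpha /\
    forall (c : R) (u : 'rV[R]_n -> R -> R),
      0 < c -> c <= cbar ->
      classical u ->
      solves_equation c Theta K u ->
      (forall (x : 'rV[R]_n) (t : R), boundary (eball 1) x -> 0 <= t -> u x t = 0) ->
      (forall x : 'rV[R]_n, eball 1 x -> lambda0 * (1 - enorm x ^+ 2) <= u x 0) ->
      (forall x : 'rV[R]_n, eball 1 x -> u x t @[t --> +oo] --> +oo) /\
      (forall (x : 'rV[R]_n) (t : R), eball 1 x -> 0 <= t ->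
        lambda0 * expR (alpha * t) * (1 - enorm x ^+ 2) <= u x t).
Proof.
have l0 : 0 < lambda0 := lt_trans hTheta hlambda0.
have n0 : 0 < n%:R :> R by rewrite ltr0n.
pose d := (lambda0 - Theta) / 2.
have d0 : 0 < d by rewrite divr_gt0// subr_gt0.
(* the radius at which lambda0 * (1 - r ^+ 2) is halfway from Theta to lambda0 *)
pose r := Num.sqrt (d / lambda0).
have r0 : 0 < r by rewrite sqrtr_gt0 divr_gt0.
have r_level : Theta + d <= lambda0 * (1 - r ^+ 2).
  have -> : r ^+ 2 = d / lambda0 by apply: sqr_sqrtr; rewrite ltW// divr_gt0.
  rewrite mulrBr mulr1 mulrCA divff ?gt_eqF// mulr1.
  by rewrite /d; lra.
have [m m0 m_mass] : exists2 m : R, 0 < m & forall x, eball 1 x ->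
    (m%:E <= kernel_mass K (eball r `&` eball 1) x)%E.
  have := hKinf _ r0.
  have inf_le x : eball 1 x -> (ereal_inf [set kernel_mass K (eball r `&` eball 1) x
      | x in eball 1] <= kernel_mass K (eball r `&` eball 1) x)%E.
    by move=> x1; apply: ereal_inf_lbound; exists x.
  case: (ereal_inf _) inf_le => [m inf_le|inf_le _|//].
  - by rewrite lte_fin => m0; exists m.
  - by exists 1 => // x /inf_le; apply: le_trans; rewrite leey.
(* growth and diffusion each get at most a quarter of d * m *)
pose alpha := d * m / (4 * lambda0).
have alpha0 : 0 < alpha by apply: divr_gt0; apply: mulr_gt0.
exists (alpha / (2 * n%:R)), alpha.
split; first by apply: divr_gt0 => //; apply: mulr_gt0.
split=> // c u c0 cbar cu eqn ubd uinit.
have gap : (alpha + 2 * n%:R * c) * lambda0 < d * m.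
  have c_le : 2 * n%:R * c <= alpha.
    by move: cbar; rewrite ler_pdivlMr ?mulr_gt0// mulrC.
  have alphaE : alpha * lambda0 = d * m / 4.
    by rewrite /alpha; field; rewrite gt_eqF.
  have : (alpha + 2 * n%:R * c) * lambda0 <= (alpha + alpha) * lambda0.
    by rewrite ler_pM2r// lerD2l.
  have : 0 < d * m by rewrite mulr_gt0.
  lra.
have bound x t : eball 1 x -> 0 <= t ->
    lambda0 * expR (alpha * t) * (1 - enorm x ^+ 2) <= u x t.
  by apply: (barrier_le R n K hK lambda0 Theta c alpha m r d) => //; exact: ltW.
split=> [x x1|]; last exact: bound.
apply: (@cvgry_expR_minorant _ _ alpha (lambda0 * (1 - enorm x ^+ 2))) => //.
  by rewrite mulr_gt0// subr_gt0; apply/eball1P.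
by move=> t t0; rewrite mulrAC; exact: bound.
Qed.
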